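(* Let ${}^1W,{}^2W,\ldots,{}^nW$ be $n$ square matrices of order $n$ over a field, where $n$ is odd. Then $$\sum_{\rho\in S^n,\ \rho_1=\mathrm{id}}\mathrm{sgn}(\rho)\,\mathrm{per}\left({}^1W^1,{}^2W^{\rho_2(1)},\ldots,{}^nW^{\rho_n(1)}\right)\prod_{i=2}^n\det\left({}^1W^i,{}^2W^{\rho_2(i)},\ldots,{}^nW^{\rho_n(i)}\right)$$ $$=(n-1)!\cdot\big(rels(n)-rols(n)\big)\,\mathrm{per}\left({}^1W\right)\prod_{j=2}^n\det\left({}^jW\right).$$
   Context: ${}^jW^i$ denotes the $i$th column of the matrix ${}^jW$, and $({}^1W^{i_1},\ldots,{}^nW^{i_n})$ denotes the $n\times n$ matrix with these columns in this order. $S^n$ is the set of $n$-tuples $\rho=(\rho_1,\ldots,\rho_n)$ of elements of the symmetric group $S_n$, and $\mathrm{sgn}(\rho)=\prod_{i=1}^n\mathrm{sgn}(\rho_i)$. $\mathrm{per}(W)$ is the permanent of the matrix $W$. Integers are interpreted in the field via the canonical ring homomorphism from $\mathbb{Z}$. A Latin square of order $n$ is an $n\times n$ array over the symbols $\{1,\ldots,n\}$ in which every symbol appears exactly once in each row and each column. Its $i$th row $L_i$ is regarded as the permutation sending $j$ to the entry $L_{i,j}$, and its $j$th column $L^j$ as the permutation sending $i$ to $L_{i,j}$. The sign of $L$ is $\mathrm{sgn}(L)=\prod_{i=1}^n\mathrm{sgn}(L_i)\,\mathrm{sgn}(L^i)$; $L$ is even if $\mathrm{sgn}(L)=1$ and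 odd if $\mathrm{sgn}(L)=-1$. $L$ is reduced if its first row and its first column are the identity permutation. $rels(n)$ and $rols(n)$ denote the numbers of reduced even and reduced odd Latin squares of order $n$, respectively. *)

(* Defs.v *)
From HB Require Import structures.
From mathcomp Require Import all_boot all_order all_fingroup all_algebra.

Set Implicit Arguments.
Unset Strict Implicit.
Unset Printing Implicit Defensive.

Import GRing.Theory.
Local Open Scope ring_scope.

(* Symbols, rows and columns are all numbered from 0, i.e. they live in 'I_n. *)

Definition sgn (n : nat) (s : 'S_n) : int := (-1) ^+ odd_perm s.

Definition sgn_tuple (n : nat) (rho : {ffun 'I_n -> 'S_n}) : int :=
  \prod_(i < n) sgn (rho i).

Definition per (R : comPzRingType) (n : nat) (A : 'M[R]_n) : R :=
  \sum_(s : 'S_n) \prod_(i < n) A i (s i).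

(* ({}^1W^{c 1}, ..., {}^nW^{c n}): column j is column (c j) of W j. *)
Definition columns_of (R : Type) (n : nat) (W : 'I_n -> 'M[R]_n)
    (c : 'I_n -> 'I_n) : 'M[R]_n :=
  \matrix_(r < n, j < n) W j r (c j).

Definition is_latin (n : nat) (L : 'M['I_n]_n) : bool :=
  [forall s : 'I_n,
    [forall i : 'I_n, #|[set j | L i j == s]| == 1%N] &&
    [forall j : 'I_n, #|[set i | L i j == s]| == 1%N]].

(* A line that is not a permutation is sent to the junk value 1; this never
   happens for a Latin square, see latin_rowE and latin_colE. *)
Definition latin_row (n : nat) (L : 'M['I_n]_n) (i : 'I_n) : 'S_n :=
  insubd (1%g : 'S_n) [ffun j => L i j].

Definition latin_col (n : nat) (L : 'M['I_n]_n) (j : 'I_n) : 'S_n :=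
  insubd (1%g : 'S_n) [ffun i => L i j].

Lemma latin_rowE (n : nat) (L : 'M['I_n]_n) (i j : 'I_n) :
  is_latin L -> latin_row L i j = L i j.
Proof.
move=> /forallP latL; rewrite /latin_row -pvalE val_insubd.
case: ifP => [_|/negP[]]; first by rewrite ffunE.
apply/injectiveP => a b; rewrite !ffunE => eq_ab.
have /andP[/forallP/(_ i)/cards1P[x defx] _] := latL (L i b).
have: a \in [set j | L i j == L i b] by rewrite inE eq_ab.
have: b \in [set j | L i j == L i b] by rewrite inE.
by rewrite defx !inE => /eqP-> /eqP->.
Qed.

Lemma latin_colE (n : nat) (L : 'M['I_n]_n) (i j : 'I_n) :
  is_latin L -> latin_col L j i = L i j.
Proof.
move=> /forallP latL; rewrite /latin_col -pvalE val_insubd.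
case: ifP => [_|/negP[]]; first by rewrite ffunE.
apply/injectiveP => a b; rewrite !ffunE => eq_ab.
have /andP[_ /forallP/(_ j)/cards1P[x defx]] := latL (L b j).
have: a \in [set i | L i j == L b j] by rewrite inE eq_ab.
have: b \in [set i | L i j == L b j] by rewrite inE.
by rewrite defx !inE => /eqP-> /eqP->.
Qed.

Definition latin_sgn (n : nat) (L : 'M['I_n]_n) : int :=
  \prod_(i < n) (sgn (latin_row L i) * sgn (latin_col L i)).

Definition latin_even (n : nat) (L : 'M['I_n]_n) : bool := latin_sgn L == 1.

Definition latin_odd (n : nat) (L : 'M['I_n]_n) : bool := latin_sgn L == -1.

(* The first index is the one whose value is 0; quantifying over it avoids
   requiring n > 0. *)
Definition is_reduced (n : nat) (L : 'M['I_n]_n) : bool :=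
  [forall i : 'I_n, (i == 0%N :> nat) ==>
    (latin_row L i == 1%g) && (latin_col L i == 1%g)].

Definition rels (n : nat) : nat :=
  #|[set L : 'M['I_n]_n | [&& is_latin L, is_reduced L & latin_even L]]|.

Definition rols (n : nat) : nat :=
  #|[set L : 'M['I_n]_n | [&& is_latin L, is_reduced L & latin_odd L]]|.

(* Main.v *)
Require Import Defs.
From HB Require Import structures.
From mathcomp Require Import all_boot all_order all_fingroup all_algebra.

Set Implicit Arguments.
Unset Strict Implicit.
Unset Printing Implicit Defensive.

Import GRing.Theory.
Local Open Scope ring_scope.

(** Expand the permanent and the [n] determinants of the left-hand side as sums
    over permutations: the matrix of index [i] contributes a permutation [s i],
    read as row [i] of an array [L], with its sign unless [i] is [0]. Once [L]
    is chosen, the sum over [rho] factors through the columns. For [j != 0] the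
    sum over [rho j] is the determinant of [W j] with its rows selected by
    column [j] of [L], which is [0] if this column repeats a symbol and is its
    sign times [\det (W j)] otherwise; for [j = 0], where [rho 0 = 1], a
    diagonal product of entries of [W 0] remains. An array whose rows, and all
    of whose columns but one, are permutations is a Latin square
    ([missing_column]), so only Latin squares survive; this is
    [expand_over_latin].

    It remains to sum, over the Latin squares with a given column [0], the
    product [core_sgn] of the signs of the rows and columns other than the
    first ones. Relabelling the symbols and permuting the columns other than
    the first turns each of them into a reduced square. Relabelling changes
    the signs of [n] rows and of [n] columns alike, and permuting the columns
    changes the signs of [n] rows; as [n] is even, [core_sgn] is preserved.
    Hence each of the [n`!] possible first rows contributes the signed number
    of reduced squares ([sum_col0]). Summing the diagonal products of [W 0]
    over all possible columns [0] then gives its permanent. *)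

(** * Signs, permanents and determinants *)

Lemma sgnM (n : nat) (s t : 'S_n) : sgn (s * t)%g = sgn s * sgn t.
Proof. by rewrite /sgn odd_permM signr_addb. Qed.

Lemma sgn1 (n : nat) : sgn (1%g : 'S_n) = 1.
Proof. by rewrite /sgn odd_perm1. Qed.

Lemma sgn_sqr (n : nat) (s : 'S_n) : sgn s * sgn s = 1.
Proof. by rewrite /sgn -signr_addb addbb. Qed.

Lemma intr_sgn (R : pzRingType) (n : nat) (s : 'S_n) :
  (sgn s)%:~R = (-1) ^+ s :> R.
Proof. by rewrite /sgn rmorph_sign. Qed.

Lemma per_tr (R : comPzRingType) (n : nat) (A : 'M[R]_n) : per A^T = per A.
Proof.
rewrite /per (reindex_inj invg_inj) /=; apply: eq_bigr => s _.
rewrite (reindex_inj (@perm_inj _ s)) /=.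
by apply: eq_bigr => i _; rewrite mxE permK.
Qed.

Lemma det_rowsub_perm (R : comPzRingType) (n : nat) (s : 'S_n) (A : 'M[R]_n) :
  \det (rowsub s A) = (sgn s)%:~R * \det A.
Proof.
rewrite intr_sgn -det_perm -det_mulmx -row_permE; congr (\det _).
by apply/matrixP=> i j; rewrite !mxE.
Qed.

Lemma det_rowsub_noninj (R : comPzRingType) (n : nat) (f : 'I_n -> 'I_n)
    (A : 'M[R]_n) :
  ~~ injectiveb f -> \det (rowsub f A) = 0.
Proof.
case/injectivePn=> i [j neq_ij eq_f].
apply: (determinant_alternate neq_ij) => k.
by rewrite !mxE eq_f.
Qed.

(** * Latin squares *)

Lemma card_fiber_inj (T : finType) (f : T -> T) (x : T) :
  injective f -> #|[set y | f y == x]| = 1%N.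
Proof.
move=> injf; rewrite -(card1 x).
rewrite -[RHS](on_card_preimset (onW_bij _ (injF_bij injf))).
by apply: eq_card => y; rewrite !inE.
Qed.

Lemma card_fiber1_inj (T : finType) (f : T -> T) :
  (forall x, #|[set y | f y == x]| = 1%N) -> injective f.
Proof.
move=> card1 a b eq_f; have /eqP/cards1P[c defc] := card1 (f b).
have: a \in [set y | f y == f b] by rewrite inE eq_f.
have: b \in [set y | f y == f b] by rewrite inE.
by rewrite defc !inE => /eqP-> /eqP->.
Qed.

Lemma is_latinP (n : nat) (L : 'M['I_n]_n) :
  reflect ((forall i, injective (L i)) /\ (forall j, injective (L^~ j)))
          (is_latin L).
Proof.
apply: (iffP forallP) => [latL | [injr injc] s].
  by split=> i; apply: card_fiber1_inj => s;
     have /andP[/forallP/(_ i)/eqP ? /forallP/(_ i)/eqP] := latL s.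
by apply/andP; split; apply/forallP=> i; rewrite card_fiber_inj.
Qed.

Lemma surj_inj (T : finType) (f : T -> T) :
  (forall y, exists x, f x = y) -> injective f.
Proof.
move=> /fin_all_exists[g gK]; apply: bij_inj.
have injg : injective g by apply: can_inj gK.
exact: (bij_can_bij (injF_bij injg) (gK : cancel g f)).
Qed.

(** For a symbol [x], let [pos i] be its position in row [i]. If [x] does not
    occur in column [j0], then [pos] avoids [j0]; injectivity of the other
    columns makes [pos] injective, hence onto, which is a contradiction. *)
Lemma missing_column (n : nat) (s : 'I_n -> 'S_n) (j0 : 'I_n) :
  (forall j, j != j0 -> injective (fun i => s i j)) ->
  injective (fun i => s i j0).
Proof.
move=> injc; apply: surj_inj => x.
have [/existsP[i /eqP eq_x] | /existsPn noj0] :=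
  boolP [exists i, s i j0 == x]; first by exists i.
pose pos i := ((s i)^-1)%g x.
have pos_neq i : pos i != j0.
  by apply: contraNneq (noj0 i) => <-; rewrite permKV.
have inj_pos : injective pos.
  move=> a b eq_pos; apply: (injc _ (pos_neq a)).
  by rewrite {2}eq_pos /pos !permKV.
by case/eqP: (pos_neq (invF inj_pos j0)); apply: f_invF.
Qed.

Definition rows_mx (n : nat) (s : {ffun 'I_n -> 'S_n}) : 'M['I_n]_n :=
  \matrix_(i, j) s i j.

Lemma latin_rows_mx (n : nat) (s : {ffun 'I_n -> 'S_n}) :
  is_latin (rows_mx s) = [forall j, injectiveb (fun i => s i j)].
Proof.
apply/is_latinP/forallP=> [[_ injc] j | injc].
  by apply/injectiveP=> a b eq_s; apply: (injc j); rewrite !mxE.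
split=> [i | j] a b; rewrite !mxE; first exact: perm_inj.
exact: (injectiveP _ (injc j)).
Qed.

Lemma rows_mx_row (n : nat) (s : {ffun 'I_n -> 'S_n}) (i : 'I_n) :
  is_latin (rows_mx s) -> latin_row (rows_mx s) i = s i.
Proof. by move=> latL; apply/permP=> j; rewrite latin_rowE // mxE. Qed.

Lemma sum_rows_mx (R : nmodType) (n : nat) (f : 'M['I_n]_n -> R) :
  \sum_(s : {ffun 'I_n -> 'S_n} | is_latin (rows_mx s)) f (rows_mx s)
  = \sum_(L : 'M['I_n]_n | is_latin L) f L.
Proof.
rewrite [RHS](reindex_onto (@rows_mx n) (fun L => [ffun i => latin_row L i])).
  apply: eq_bigl => s; case: (boolP (is_latin _)) => //= latL; apply/esym/eqP.
  by apply/ffunP=> i; rewrite ffunE rows_mx_row.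
move=> L latL; apply/matrixP=> i j.
by rewrite mxE ffunE latin_rowE.
Qed.

Definition core_sgn (n : nat) (L : 'M['I_n.+1]_n.+1) : int :=
  \prod_(i < n.+1 | i != ord0) (sgn (latin_row L i) * sgn (latin_col L i)).

Lemma is_reducedE (n : nat) (L : 'M['I_n.+1]_n.+1) :
  is_reduced L = (latin_row L ord0 == 1%g) && (latin_col L ord0 == 1%g).
Proof.
apply/forallP/idP=> [/(_ ord0)|redL i]; first by rewrite eqxx.
by apply/implyP=> i0; have /eqP-> : i == ord0 by [].
Qed.

(** The two lines missing from [core_sgn] are identities in a reduced square. *)
Lemma core_sgn_reduced (n : nat) (L : 'M['I_n.+1]_n.+1) :
  is_reduced L -> core_sgn L = latin_sgn L.
Proof.
rewrite is_reducedE => /andP[/eqP row1 /eqP col1].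
by rewrite /latin_sgn (bigD1 ord0) //= row1 col1 sgn1 !mul1r.
Qed.

Lemma latin_sgn_pm1 (n : nat) (L : 'M['I_n]_n) :
  latin_sgn L = (latin_even L)%:R - (latin_odd L)%:R.
Proof.
rewrite /latin_even /latin_odd; suff /predU1P[->|/eqP->] :
  (latin_sgn L == 1) || (latin_sgn L == -1) by [].
rewrite -sqrf_eq1 /latin_sgn -prodrXl big1 // => i _.
by rewrite exprMn !expr2 !sgn_sqr.
Qed.

Lemma sum_reduced (n : nat) :
  \sum_(L : 'M['I_n.+1]_n.+1 | is_latin L && is_reduced L) core_sgn L
  = (rels n.+1)%:Z - (rols n.+1)%:Z.
Proof.
have cardE (p q : pred 'M['I_n.+1]_n.+1) :
    #|[set L | [&& is_latin L, p L & q L]]|%:Z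
    = \sum_(L | is_latin L && p L) (q L)%:R.
  rewrite -sum1_card -[LHS]natz natr_sum /= [RHS]big_mkcond [LHS]big_mkcond /=.
  by apply: eq_bigr => L _; rewrite inE;
     case: (is_latin L) (p L) (q L) => [] [] [].
rewrite /rels /rols !cardE -sumrB; apply: eq_bigr => L /andP[_ redL].
by rewrite core_sgn_reduced // latin_sgn_pm1.
Qed.

(** * Normalising a Latin square *)

Definition relabel (n : nat) (t p : 'S_n) (L : 'M['I_n]_n) : 'M['I_n]_n :=
  \matrix_(i, j) t (L i (p j)).

Lemma relabelK (n : nat) (t p : 'S_n) :
  cancel (relabel t p) (relabel t^-1 p^-1).
Proof. by move=> L; apply/matrixP=> i j; rewrite !mxE permKV permK. Qed.

Lemma relabelKV (n : nat) (t p : 'S_n) :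
  cancel (relabel t^-1 p^-1) (relabel t p).
Proof. by move=> L; apply/matrixP=> i j; rewrite !mxE permKV permK. Qed.

Lemma relabel_latin (n : nat) (t p : 'S_n) (L : 'M['I_n]_n) :
  is_latin (relabel t p L) = is_latin L.
Proof.
suff imp u q M : is_latin M -> is_latin (@relabel n u q M).
  by apply/idP/idP=> [/(imp t^-1 p^-1)%g | /imp //]; rewrite relabelK.
move=> /is_latinP[injr injc]; apply/is_latinP.
split=> k a b; rewrite !mxE => /perm_inj; last exact: injc.
by move=> /injr/perm_inj.
Qed.

Lemma relabel_row (n : nat) (t p : 'S_n) (L : 'M['I_n]_n) (i : 'I_n) :
  is_latin L -> latin_row (relabel t p L) i = (p * latin_row L i * t)%g.
Proof.
move=> latL; apply/permP=> j.
by rewrite latin_rowE ?relabel_latin // !permM latin_rowE // mxE.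
Qed.

Lemma relabel_col (n : nat) (t p : 'S_n) (L : 'M['I_n]_n) (j : 'I_n) :
  is_latin L -> latin_col (relabel t p L) j = (latin_col L (p j) * t)%g.
Proof.
move=> latL; apply/permP=> i.
by rewrite latin_colE ?relabel_latin // !permM latin_colE // mxE.
Qed.

(** Each row and each column picks up [sgn t], so these signs cancel in pairs;
    each of the [n] rows picks up [sgn p], and [n] is even. Since [p] fixes
    [ord0], it only permutes the columns other than the first. *)
Lemma core_sgn_relabel (n : nat) (t p : 'S_n.+1) (L : 'M['I_n.+1]_n.+1) :
  odd n.+1 -> p ord0 = ord0 -> is_latin L ->
  core_sgn (relabel t p L) = core_sgn L.
Proof.
move=> n_odd p0 latL; rewrite /core_sgn.
under eq_bigr => i _.
  rewrite relabel_row // relabel_col // !sgnM mulrACA sgn_sqr mulr1 -mulrA.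
  over.
have p_neq0 i : (p i != ord0) = (i != ord0).
  by rewrite -{1}p0 (inj_eq perm_inj).
have eq_cols : \prod_(i < n.+1 | i != ord0) sgn (latin_col L (p i))
    = \prod_(i < n.+1 | i != ord0) sgn (latin_col L i).
  by rewrite [RHS](reindex_inj (@perm_inj _ p)); apply: eq_bigl.
rewrite !big_split /= eq_cols.
rewrite prodr_const cardC1 card_ord /sgn -exprM mulnC exprM.
have: ~~ odd n by [].
by rewrite -signr_odd => /negbTE->; rewrite expr0 expr1n mul1r.
Qed.

Definition fixing0 (n : nat) : {set 'S_n.+1} :=
  [set p : 'S_n.+1 | p ord0 == ord0].

Lemma card_fixing0 (n : nat) : #|fixing0 n| = n`!.
Proof.
transitivity #|[set~ (ord0 : 'I_n.+1)]|`!; last by rewrite cardsC1 card_ord.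
rewrite -card_perm.
apply: eq_card => p; rewrite !inE; apply/eqP/subsetP=> [p0 i | onp].
  by rewrite !inE; apply: contraNneq => ->; rewrite p0.
by apply: contraTeq isT => p0; move: (onp ord0); rewrite !inE p0 => /(_ isT).
Qed.

(** The squares with column [t] and first row [p * t] are the relabellings by
    [t] and [p] of the reduced squares, and the possible [p] are the
    permutations fixing [ord0]. *)
Lemma sum_col0 (n : nat) (t : 'S_n.+1) : odd n.+1 ->
  \sum_(L : 'M['I_n.+1]_n.+1 | is_latin L && (latin_col L ord0 == t))
    core_sgn L
  = (n`!)%:R * ((rels n.+1)%:Z - (rols n.+1)%:Z).
Proof.
move=> n_odd; rewrite -sum_reduced.
rewrite (partition_big (fun L => latin_row L ord0 * t^-1)%g (mem (fixing0 n)))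
  /=; last first.
  move=> L /andP[latL /eqP colt]; rewrite inE permM latin_rowE //.
  by rewrite -colt -(latin_colE _ _ latL) permK.
rewrite mulr_natl -card_fixing0 -sumr_const; apply: eq_bigr => p.
rewrite inE => /eqP p0.
rewrite (reindex_onto (relabel t p) (relabel t^-1 p^-1)) /=; last first.
  by move=> L _; exact: relabelKV.
apply: eq_big => [L | L /andP[/andP[/andP[latL _] _] _]]; last first.
  by rewrite core_sgn_relabel // -(relabel_latin t p).
rewrite relabelK eqxx andbT relabel_latin is_reducedE -andbA.
case: (boolP (is_latin L)) => //= latL.
rewrite relabel_row // relabel_col // p0 mulgK andbC.
by rewrite -{2}[t]mul1g (inj_eq (mulIg t)) -{2}[p]mulg1 (inj_eq (mulgI p)).
Qed.

(** * Expansion over Latin squares *)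

(** Both sides come from one double sum over [rho] and the array of rows [s],
    whose terms are, up to sign, products over the cells [(i, j)]; grouping the
    cells by rows gives the left-hand side, grouping them by columns the
    right-hand side. *)
Lemma expand_over_latin (R : comNzRingType) (n : nat)
    (W : 'I_n.+1 -> 'M[R]_n.+1) :
  \sum_(rho : {ffun 'I_n.+1 -> 'S_n.+1} | rho ord0 == 1%g)
     (sgn_tuple rho)%:~R
     * per (columns_of W (fun j => rho j ord0))
     * \prod_(i < n.+1 | i != ord0) \det (columns_of W (fun j => rho j i))
  = \sum_(L : 'M['I_n.+1]_n.+1 | is_latin L)
     (core_sgn L)%:~R * (\prod_i W ord0 (L i ord0) i)
     * \prod_(j < n.+1 | j != ord0) \det (W j).
Proof.
pose row_wt (i : 'I_n.+1) (s : 'S_n.+1) : R :=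
  if i == ord0 then 1 else (sgn s)%:~R.
have expand_rows (rho : {ffun 'I_n.+1 -> 'S_n.+1}) :
    per (columns_of W (fun j => rho j ord0))
     * \prod_(i < n.+1 | i != ord0) \det (columns_of W (fun j => rho j i))
  = \sum_(s : {ffun 'I_n.+1 -> 'S_n.+1})
      \prod_i (row_wt i (s i) * \prod_j W j (s i j) (rho j i)).
  rewrite -(bigA_distr_bigA (fun i t =>
    row_wt i t * \prod_j W j (t j) (rho j i))) [RHS](bigD1 ord0) //=.
  congr (_ * _).
    rewrite -per_tr; apply: eq_bigr => t _; rewrite /row_wt eqxx mul1r.
    by apply: eq_bigr => j _; rewrite !mxE.
  apply: eq_bigr => i i_neq0; rewrite -det_tr; apply: eq_bigr => t _.
  rewrite /row_wt (negbTE i_neq0) intr_sgn; congr (_ * _).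
  by apply: eq_bigr => j _; rewrite !mxE.
under eq_bigr => rho _ do rewrite -mulrA expand_rows big_distrr /=.
rewrite exchange_big /=.
pose line_sum (s : {ffun 'I_n.+1 -> 'S_n.+1}) : R :=
  (\prod_i W ord0 (s i ord0) i)
  * \prod_(j < n.+1 | j != ord0) \det (rowsub (fun i => s i j) (W j)).
have expand_cols (s : {ffun 'I_n.+1 -> 'S_n.+1}) :
  \sum_(rho : {ffun 'I_n.+1 -> 'S_n.+1} | rho ord0 == 1%g)
     (sgn_tuple rho)%:~R
     * \prod_i (row_wt i (s i) * \prod_j W j (s i j) (rho j i))
  = \prod_i row_wt i (s i) * line_sum s.
  (* The constraint [rho ord0 = 1] in the form of a family of independent
     conditions, so that the sum over [rho] distributes over the columns. *)
  pose admissible (j : 'I_n.+1) (t : 'S_n.+1) := (j == ord0) ==> (t == 1%g).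
  transitivity (\prod_i row_wt i (s i) *
    \sum_(rho in family admissible)
      \prod_j ((sgn (rho j))%:~R * \prod_i W j (s i j) (rho j i))).
    rewrite big_distrr /=; apply: eq_big => [rho | rho _].
      apply/idP/familyP=> [/eqP rho0 j | /(_ ord0)].
        by apply/implyP=> /eqP->; apply/eqP.
      by rewrite unfold_in eqxx.
    rewrite !big_split /= mulrCA /sgn_tuple rmorph_prod; congr (_ * (_ * _)).
    exact: exchange_big.
  rewrite -(bigA_distr_big_dep admissible (fun j t =>
    (sgn t)%:~R * \prod_i W j (s i j) (t i))) /line_sum.
  congr (_ * _); rewrite (bigD1 ord0) //=; congr (_ * _).
    rewrite (big_pred1 1%g) // sgn1 mul1r.
    by apply: eq_bigr => i _; rewrite perm1.
  apply: eq_bigr => j j_neq0; apply: eq_big => [t | t _].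
    by rewrite /admissible (negbTE j_neq0).
  by rewrite intr_sgn; congr (_ * _); apply: eq_bigr => i _; rewrite !mxE.
under eq_bigr => s _ do rewrite expand_cols.
rewrite (bigID (fun s => is_latin (rows_mx s))) /= [X in _ + X]big1 ?addr0.
  rewrite -[RHS]sum_rows_mx; apply: eq_bigr => s latL.
  rewrite /core_sgn big_split rmorphM /= !rmorph_prod /= -!mulrA.
  rewrite (bigD1 ord0) //= {1}/row_wt eqxx mul1r; congr (_ * _).
    apply: eq_bigr => i /negbTE i_neq0.
    by rewrite /row_wt i_neq0 rows_mx_row.
  rewrite /line_sum mulrCA -big_split /=; congr (_ * _).
    by apply: eq_bigr => i _; rewrite mxE.
  apply: eq_bigr => j _; rewrite -det_rowsub_perm; congr (\det _).
  by apply/matrixP=> i k; rewrite !mxE latin_colE // mxE.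
(* The rows being permutations, a non-Latin array repeats a symbol in a column
   other than the first, and the determinant of that column vanishes. *)
move=> s; rewrite latin_rows_mx => nlat.
have [j j_neq0 ninj] :
    exists2 j, j != ord0 & ~~ injectiveb (fun i => s i j).
  apply/exists_inP; apply: contraR nlat => /exists_inPn inj_cols.
  have inj_col j : j != ord0 -> injective (fun i => s i j).
    by move=> /inj_cols; rewrite negbK => /injectiveP.
  apply/forallP=> j; apply/injectiveP.
  by case: (eqVneq j ord0) => [->|]; [exact: missing_column | exact: inj_col].
by rewrite /line_sum [X in _ * (_ * X)](bigD1 j) //=
  (det_rowsub_noninj _ ninj) mul0r !mulr0.
Qed.

Theorem theorem3p2 (F : fieldType) (n : nat) (W : 'I_n.+1 -> 'M[F]_n.+1)
    (n_odd : odd n.+1) :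
  \sum_(rho : {ffun 'I_n.+1 -> 'S_n.+1} | rho ord0 == 1%g)
     (sgn_tuple rho)%:~R
     * per (columns_of W (fun j => rho j ord0))
     * \prod_(i < n.+1 | i != ord0) \det (columns_of W (fun j => rho j i))
  = (n`!)%:R * ((rels n.+1)%:Z - (rols n.+1)%:Z)%:~R
    * per (W ord0) * \prod_(j < n.+1 | j != ord0) \det (W j).
Proof.
rewrite expand_over_latin -big_distrl /=; congr (_ * _).
rewrite (partition_big (fun L => latin_col L ord0) xpredT) //=.
rewrite -[per (W ord0)]per_tr /per big_distrr /=; apply: eq_bigr => t _.
transitivity (\sum_(L | is_latin L && (latin_col L ord0 == t))
  (core_sgn L)%:~R * \prod_i (W ord0)^T i (t i)).
  apply: eq_bigr => L /andP[latL /eqP col0]; congr (_ * _).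
  by apply: eq_bigr => i _; rewrite mxE -col0 latin_colE.
rewrite -big_distrl -rmorph_sum /= sum_col0 // rmorphM /=.
by rewrite rmorph_nat.
Qed.
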